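(* Let $$G=\begin{pmatrix} A & B \\ B^t & C \end{pmatrix}$$ be a partially specified real symmetric matrix, where $A$ and $C$ are square matrices of sizes $m$ and $n$ respectively and $A$ is positive semidefinite. Suppose the diagonal entries of $C$ are the only unspecified entries of $G$. If $\mathcal{C}(B)\subseteq\mathcal{C}(A)$, then it is possible to fill in the diagonal entries of $C$ with positive real numbers so that $G$ becomes positive semidefinite.
   Context: $\mathcal{C}(M)$ denotes the column space of a real matrix $M$. Partially specified symmetric means that all entries other than the unspecified ones are given real numbers, and the $(i,j)$ and $(j,i)$ entries agree. *)

(* Defs.v *)
From mathcomp Require Import all_boot all_order all_algebra.
From mathcomp Require Import classical_sets reals.

Set Implicit Arguments.
Unset Strict Implicit.
Unset Printing Implicit Defensive.

Import Order.TTheory GRing.Theory Num.Theory.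
Local Open Scope classical_set_scope.
Local Open Scope ring_scope.

Definition psdmx (R : realType) (n : nat) (A : 'M[R]_n) : Prop :=
  A^T = A /\ forall x : 'cV[R]_n, 0 <= (x^T *m A *m x) ord0 ord0.

Definition colspace (R : realType) (m n : nat) (M : 'M[R]_(m, n)) :
  set 'cV[R]_m := range (fun x : 'cV[R]_n => M *m x).

(* A partially specified matrix has entries in [option R]: [Some a] is the
   given entry [a] and [None] is an unspecified entry.  Since [option R] is
   compared with [=], [G^T = G] says that the unspecified positions are
   symmetric and that the given entries agree across the diagonal. *)
Definition partial_symmetric (R : realType) (n : nat)
  (G : 'M[option R]_n) : Prop := G^T = G.

Definition completes (R : realType) (n : nat)
    (H : 'M[R]_n) (G : 'M[option R]_n) : Prop :=
  forall i j a, G i j = Some a -> H i j = a.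

(* Main.v *)
Require Import Defs.
From mathcomp Require Import all_boot all_order all_algebra.
From mathcomp Require Import classical_sets reals.
From mathcomp Require Import lra.

Set Implicit Arguments.
Unset Strict Implicit.
Unset Printing Implicit Defensive.

Import Order.TTheory GRing.Theory Num.Theory.
Local Open Scope classical_set_scope.
Local Open Scope ring_scope.

(** Column by column, the inclusion [colspace B `<=` colspace A] yields a
    factorization [B = A *m X] ([colspace_sub_factor]), so a completion of [G]
    whose lower right block is [D] is
      [block_mx A (A *m X) (A *m X)^T D].
    Completing the square, its quadratic form at [col_mx u v] is
      [(u + X v)^T A (u + X v) + v^T (D - X^T A X) v],
    so it is nonnegative as soon as the generalized Schur complement
    [D - X^T A X] is positive semidefinite ([psdmx_block]). Filling the diagonal
    of [C] with one common value [t] makes this complement [S + t I], where [S]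
    is a fixed symmetric matrix, and such a matrix is positive semidefinite
    once [t] is at least the sum of the absolute values of the entries of [S]
    ([psdmx_add_scalar]). Since no upper bound is imposed on [t], it can
    be taken positive. *)

Lemma colspace_sub_factor (R : realType) (m n p : nat)
    (A : 'M[R]_(m, n)) (B : 'M[R]_(m, p)) :
  colspace B `<=` colspace A -> exists X : 'M[R]_(n, p), B = A *m X.
Proof.
move=> sBA.
have colB j : exists x : 'cV[R]_n, A *m x == col j B.
  have [|x _ Ax] := sBA (col j B); last by exists x; apply/eqP.
  by exists (delta_mx j ord0); rewrite // colE.
pose X := \matrix_(i, j) xchoose (colB j) i ord0.
exists X; apply/matrixP => i j.
have /eqP/matrixP/(_ i ord0) := xchooseP (colB j).
by rewrite !mxE => <-; apply: eq_bigr => k _; rewrite mxE.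
Qed.

(** Each [|v_i v_j|] is at most [(v_i^2 + v_j^2) / 2], hence at most [|v|^2], so
    the form of [S] is at least [- (\sum_i \sum_j `|S i j|) |v|^2]. *)
Lemma psdmx_add_scalar (R : realType) (n : nat) (S : 'M[R]_n) (t : R) :
  S^T = S -> \sum_i \sum_j `|S i j| <= t -> psdmx (S + t%:M).
Proof.
move=> symS le_t; split=> [|v]; first by rewrite linearD /= tr_scalar_mx symS.
pose q := \sum_i v i ord0 ^+ 2.
have q_ge0 : 0 <= q by apply: sumr_ge0 => i _; apply: sqr_ge0.
have le_q i : v i ord0 ^+ 2 <= q.
  by rewrite /q (bigD1 i) //= lerDl; apply: sumr_ge0 => k _; apply: sqr_ge0.
have le_norm i j : `|v i ord0 * v j ord0| <= q.
  have := le_q i; have := le_q j; rewrite normrM.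
  rewrite -(real_normK (num_real (v i ord0))).
  rewrite -(real_normK (num_real (v j ord0))).
  by have := sqr_ge0 (`|v i ord0| - `|v j ord0|); nra.
rewrite mulmxDr mulmxDl mxE.
have -> : (v^T *m t%:M *m v) ord0 ord0 = t * q.
  rewrite mul_mx_scalar -scalemxAl mxE; congr (_ * _).
  by rewrite mxE; apply: eq_bigr => i _; rewrite mxE expr2.
have -> : (v^T *m S *m v) ord0 ord0
    = \sum_j \sum_i S i j * (v i ord0 * v j ord0).
  rewrite mxE; apply: eq_bigr => j _; rewrite mxE mulr_suml.
  by apply: eq_bigr => i _; rewrite mxE mulrCA mulrA.
rewrite exchange_big /= -[X in 0 <= X + _]opprK addrC subr_ge0.
apply: le_trans (ler_wpM2r q_ge0 le_t).
apply: le_trans (ler_norm _) _; rewrite normrN mulr_suml.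
apply: le_trans (ler_norm_sum _ _ _) _; apply: ler_sum => i _.
rewrite mulr_suml.
apply: le_trans (ler_norm_sum _ _ _) _; apply: ler_sum => j _.
by rewrite normrM ler_wpM2l.
Qed.

(** Schur complement criterion without inverting [A]: [X^T A X] takes the place
    of [B^T A^-1 B] for [B = A X]. The congruence [(u, v) |-> (u + X v, v)] turns
    the block matrix into the direct sum of [A] and the complement. *)
Lemma psdmx_block (R : realType) (m n : nat)
    (A : 'M[R]_m) (X : 'M[R]_(m, n)) (D : 'M[R]_n) :
  psdmx A -> psdmx (D - X^T *m A *m X) ->
  psdmx (block_mx A (A *m X) (A *m X)^T D).
Proof.
move=> [symA posA] [symS posS]; split=> [|x].
  have symXAX : (X^T *m A *m X)^T = X^T *m A *m X.
    by rewrite !trmx_mul trmxK symA mulmxA.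
  have symD : D^T = D.
    by move: symS; rewrite linearB /= symXAX; apply: addIr.
  by rewrite tr_block_mx trmxK symA symD.
rewrite -[x]vsubmxK; set u := usubmx x; set v := dsubmx x.
suff -> : (col_mx u v)^T *m block_mx A (A *m X) (A *m X)^T D *m col_mx u v
    = (u + X *m v)^T *m A *m (u + X *m v)
      + v^T *m (D - X^T *m A *m X) *m v.
  by rewrite mxE addr_ge0.
have -> : (u + X *m v)^T = u^T + v^T *m X^T by rewrite linearD /= trmx_mul.
rewrite tr_col_mx mul_row_block mul_row_col trmx_mul symA.
rewrite mulmxBr mulmxBl !(mulmxDl, mulmxDr) !mulmxA.
by rewrite -!addrA [_ + (v^T *m D *m v - _)]addrC subrK.
Qed.

Theorem lemma3p17 (R : realType) (m n : nat)
    (A : 'M[R]_m) (B : 'M[R]_(m, n)) (C : 'M[option R]_n)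
    (G : 'M[option R]_(m + n))
    (hG : G = block_mx (map_mx Some A) (map_mx Some B)
                       (map_mx Some B^T) C)
    (hGsym : partial_symmetric G)
    (hA : psdmx A)
    (hC : forall i j : 'I_(m + n),
        G i j = None <-> exists k : 'I_n, i = rshift m k /\ j = rshift m k)
    (hBA : colspace B `<=` colspace A) :
  exists H : 'M[R]_(m + n),
    [/\ completes H G,
        forall k : 'I_n, 0 < drsubmx H k k
      & psdmx H].
Proof.
have [X defB] := colspace_sub_factor hBA.
have diagC k : C k k = None.
  have : G (rshift m k) (rshift m k) = None by apply/hC; exists k.
  by rewrite hG block_mxEdr.
have symC : C^T = C.
  by move: hGsym; rewrite /partial_symmetric hG tr_block_mx => /eq_block_mx[].
pose C0 := map_mx (odflt 0) C.
pose S := C0 - X^T *m A *m X.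
(* The summand 1 keeps the new diagonal entries positive even when [S = 0]. *)
pose t := 1 + \sum_i \sum_j `|S i j|.
have sum_ge0 : 0 <= \sum_i \sum_j `|S i j|.
  by apply: sumr_ge0 => i _; apply: sumr_ge0.
exists (block_mx A B B^T (C0 + t%:M)); split.
- move=> i j a; rewrite hG.
  case: (split_ordP i) => i' ->; case: (split_ordP j) => j' ->;
    rewrite ?block_mxEul ?block_mxEur ?block_mxEdl ?block_mxEdr.
  + by rewrite mxE => -[].
  + by rewrite mxE => -[].
  + by rewrite mxE => -[].
  + have [<-|neq_ij Ca] := eqVneq i' j'; first by rewrite diagC.
    by rewrite !mxE Ca (negPf neq_ij) addr0.
- by move=> k; rewrite block_mxKdr !mxE diagC eqxx add0r ltr_pwDl.
- rewrite defB; apply: psdmx_block => //.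
  rewrite addrAC -/S; apply: psdmx_add_scalar; last by rewrite lerDr.
  rewrite /S linearB /= /C0 matrix.map_trmx symC !trmx_mul trmxK mulmxA.
  by case: hA => ->.
Qed.
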